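(* Let $\mathcal{X}$ be $\mathbb{Z}$ or a segment (interval of consecutive integers) of $\mathbb{Z}$, and let $P$ be a one-dependent point process on $\mathcal{X}$ with correlation function $\rho$. Then $P$ is determinantal. Its correlation kernel can be written in the form, for $x,y\in\mathcal{X}$, $$K(x,y)=\begin{cases}0 & \text{if } x-y\ge 2,\\ -1 & \text{if } x-y=1,\\ \displaystyle\sum_{r=1}^{y-x+1}(-1)^{r-1}\sum_{x=l_0<l_1<\cdots<l_r=y+1}\rho([l_0,l_1))\,\rho([l_1,l_2))\cdots\rho([l_{r-1},l_r)) & \text{if } x\le y,\end{cases}$$ where the inner sum is over integers $l_0<\dots<l_r$ with $l_0=x$, $l_r=y+1$.
   Context: A point process on a discrete set $\mathcal{X}$ is a probability measure $P$ on subsets $S$ of $\mathcal{X}$ (a random subset). Its correlation function is $\rho(A)=P\{S: S\supseteq A\}$ for finite $A\subseteq\mathcal{X}$. For $\mathcal{X}$ equal to $\mathbb{Z}$ or a segment of $\mathbb{Z}$, the process is one-dependent if $\rho(X\cup Y)=\rho(X)\rho(Y)$ for all finite $X,Y\subseteq\mathcal{X}$ with $\mathrm{dist}(X,Y)\ge 2$, i.e. $|x-y|\ge 2$ for all $x\in X,y\in Y$. The process is determinantal with correlation kernel $K:\mathcal{X}\times\mathcal{X}\to\mathbb{C}$ if $\rho(A)=\det(K(x,y))_{x,y\in A}$ for every finite $A\subseteq\mathcal{X}$ (kernels need not be symmetric). The notation $[a,b)$ stands for $\{a,a+1,\dots,b-1\}$. *)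

(* Defs.v *)
From HB Require Import structures.
From mathcomp Require Import all_boot all_order all_algebra finmap.
From mathcomp Require Import complex.
From mathcomp Require Import all_classical all_reals all_analysis.

Set Implicit Arguments.
Unset Strict Implicit.
Unset Printing Implicit Defensive.

Import Order.TTheory GRing.Theory Num.Theory.
Local Open Scope classical_set_scope.
Local Open Scope ring_scope.

Section PointProcess.
Context {T : choiceType}.

Definition cylinders : set (set (set T)) :=
  [set [set S : set T | S x] | x in [set: T]].

Definition configuration := g_sigma_algebraType cylinders.

Context {R : realType}.

(* The value is finite since P is a probability measure.  It is defined for
   every A, but is only used for finite A. *)
Definition correlation (P : probability configuration R) (A : set T) : R :=
  fine (P [set S : set T | A `<=` S]).

(* For A = {a_0, ..., a_(k-1)}, the matrix (K a_i a_j)_(i, j); its determinant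
   does not depend on the enumeration of A. *)
Definition kernel_matrix (C : Type) (K : T -> T -> C) (A : {fset T}) :=
  \matrix_(i < #|{: A}|, j < #|{: A}|) K (val (enum_val i)) (val (enum_val j)).

Definition is_correlation_kernel (P : probability configuration R)
    (K : T -> T -> R[i]) : Prop :=
  forall A : {fset T},
    (correlation P [set` A])%:C%C = \det (kernel_matrix K A).

Definition determinantal (P : probability configuration R) : Prop :=
  exists K : T -> T -> R[i], is_correlation_kernel P K.

End PointProcess.
Arguments configuration T : clear implicits.

Section OneDependent.
Context {R : realType} {X : set int}.
Implicit Type P : probability (configuration X) R.

Definition one_dependent P : Prop :=
  forall A B : {fset X},
    (forall x y : X, x \in A -> y \in B -> 2 <= `|val x - val y|) ->
    correlation P ([set` A] `|` [set` B]) =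
    correlation P [set` A] * correlation P [set` B].

Definition rho_itv P (a b : int) : R :=
  correlation P [set z : X | a <= val z < b].

(* A chain x = l_0 < l_1 < ... < l_r = x + n of integers is encoded by its
   offsets t i = l_i - x, which lie in {0, ..., n}. *)
Definition is_chain (n r : nat) (t : {ffun 'I_r.+1 -> 'I_n.+1}) : bool :=
  [&& t ord0 == ord0, t ord_max == ord_max &
      [forall i : 'I_r, (t (inord i) < t (inord i.+1))%N]].

Definition chain_sum P (x : int) (n r : nat) : R :=
  \sum_(t : {ffun 'I_r.+1 -> 'I_n.+1} | is_chain t)
    \prod_(i < r) rho_itv P (x + (t (inord i))%:Z) (x + (t (inord i.+1))%:Z).

(* When x <= y, the natural number `|y - x|.+1 is y - x + 1. *)
Definition one_dependent_kernel P (x y : X) : R[i] :=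
  if 2 <= val x - val y then 0
  else if val x - val y == 1 then -1
  else (\sum_(1 <= r < `|val y - val x|%N.+2)
          (-1) ^+ r.-1 * chain_sum P (val x) `|val y - val x|%N.+1 r)%:C%C.

End OneDependent.

(* Main.v *)
(* Let R(a, b) = rho([a, b)) for a <= b, a unitriangular matrix.  The alternating
   sum over chains defining K says K(x, y) = - R^-1(x, y + 1), also for
   x >= y + 1, so that R^-1 R = 1 reads
     rho([x, b)) = sum_(x <= l < b) K(x, l) rho([l + 1, b)).
   For a finite set A with minimum c, the matrix of K on A is Hessenberg.
   Replace its first row by (K(x, a))_(a in A), with x <= c; expanding along the
   first column and using one-dependence at the first gap of A, induction on A
   shows that its determinant is
     rho([x, c) U A) - sum_(x <= l < c) K(x, l) rho([l + 1, c) U A),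
   and x = c gives rho(A). *)
Require Import Defs.
From mathcomp Require Import all_boot all_order all_algebra finmap.
From mathcomp Require Import complex.
From mathcomp Require Import all_classical all_reals all_analysis.
From mathcomp Require Import perm zify.
Import Order.TTheory GRing.Theory Num.Theory.

Local Open Scope classical_set_scope.
Local Open Scope ring_scope.

(** * Integer intervals as lists *)

Definition itv_seq (x : int) (n : nat) : seq int :=
  [seq x + i%:Z | i <- iota 0 n].

Lemma itv_seqS x n : itv_seq x n.+1 = rcons (itv_seq x n) (x + n%:Z).
Proof. by rewrite /itv_seq -addn1 iotaD map_cat cats1. Qed.

Lemma mem_itv_seq x n z : (z \in itv_seq x n) = (x <= z < x + n%:Z).
Proof.
apply/mapP/idP => [[k]|xzn]; first by rewrite mem_iota => ? ->; lia.
by exists `|z - x|%N; rewrite ?mem_iota; lia.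
Qed.

(** * Expansion of Hessenberg determinants with a modified first row *)

Definition row0_matrix {F : comNzRingType} (K : int -> int -> F) (x : int)
    (s : seq int) : 'M[F]_(size s) :=
  \matrix_(i, j) K (if i == 0%N :> nat then x else s`_i) s`_j.

Section Hessenberg.
Context {F : comNzRingType} (K : int -> int -> F).
Context (K_far : forall x y, y + 2 <= x -> K x y = 0).

Lemma det_row0_seq1 x c : \det (row0_matrix K x [:: c]) = K x c.
Proof. by rewrite det_mx11 mxE. Qed.

(** By [K_far] only the top two entries of the first column survive. Deleting row 0 puts row [d] on
    top, deleting row 1 keeps [x] there, so both minors are again of the form [row0_matrix]. *)
Lemma det_row0_cons x c d s : path <%R c (d :: s) ->
  \det (row0_matrix K x [:: c, d & s]) =
  K x c * \det (row0_matrix K d (d :: s)) -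
  K d c * \det (row0_matrix K x (d :: s)).
Proof.
move=> /= /andP[cd ds]; have far z : z \in s -> c + 2 <= z.
  by move=> zs; have /allP/(_ z zs) := order_path_min lt_trans ds; lia.
rewrite (expand_det_col _ ord0) !big_ord_recl big1 ?addr0 => [|i _].
  rewrite !mxE /= /cofactor !addn0 /bump /= expr0 mul1r expr1 mulN1r mulrN.
  by congr (_ * _ - _ * _); congr (\det _); apply/matrixP => i j;
    rewrite !mxE /=; case: i => [[|i] hi].
rewrite mxE /= K_far ?mul0r//.
exact/far/mem_nth/ltn_ord.
Qed.

End Hessenberg.

(** * From one-dependence to the determinant on increasing lists *)

Section OneDependentDeterminant.
Context {F : comNzRingType} (rho : seq int -> F) (K : int -> int -> F).
Context (rho_nil : rho [::] = 1).
Context (rho_cat : forall s t,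
  (forall x y, x \in s -> y \in t -> x + 2 <= y) ->
  rho (s ++ t) = rho s * rho t).
Context (K_far : forall x y, y + 2 <= x -> K x y = 0).
Context (K_sub : forall y, K (y + 1) y = -1).
Context (rho_itv_seq : forall x n,
  rho (itv_seq x n.+1) =
  \sum_(l < n.+1) K x (x + l%:Z) * rho (itv_seq (x + l.+1%:Z) (n - l))).

Lemma rho_gap x n s : (forall z, z \in s -> x + n%:Z + 2 <= z) ->
  rho (itv_seq x n ++ x + n%:Z :: s) = rho (itv_seq x n.+1) * rho s.
Proof.
move=> far; rewrite -cat_rcons -itv_seqS rho_cat// => u v.
by rewrite mem_itv_seq => ? /far; lia.
Qed.

(** The recursion [rho_itv_seq] is solved for its last term and multiplied by [rho s]; the gap after
    [x + n] lets every correlation absorb that factor. *)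
Lemma kernel_gap x n s : (forall z, z \in s -> x + n%:Z + 2 <= z) ->
  K x (x + n%:Z) * rho s = rho (itv_seq x n ++ x + n%:Z :: s) -
    \sum_(l < n) K x (x + l%:Z) *
      rho (itv_seq (x + l.+1%:Z) (n - l.+1) ++ x + n%:Z :: s).
Proof.
move=> far; rewrite rho_gap// rho_itv_seq big_ord_recr /= subnn rho_nil.
rewrite mulr1 mulrDl addrAC mulr_suml -sumrB big1 ?add0r// => l _.
have -> : x + n%:Z = x + l.+1%:Z + (n - l.+1)%N%:Z by have := ltn_ord l; lia.
by rewrite rho_gap => [|z /far]; [rewrite -mulrA subnSK ?subrr | have := ltn_ord l; lia].
Qed.

Lemma det_row0_rho x n s : sorted <%R (x + n%:Z :: s) ->
  \det (row0_matrix K x (x + n%:Z :: s)) =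
  rho (itv_seq x n ++ x + n%:Z :: s) -
  \sum_(l < n) K x (x + l%:Z) *
    rho (itv_seq (x + l.+1%:Z) (n - l.+1) ++ x + n%:Z :: s).
Proof.
elim: s x n => [|d s IHs] x n sorted_s.
  by rewrite det_row0_seq1 -kernel_gap// rho_nil mulr1.
rewrite det_row0_cons//; have /= /andP[ltxd ds] := sorted_s.
(* The induction hypothesis with base point [d] and [n = 0], where the sum is empty. *)
have -> : \det (row0_matrix K d (d :: s)) = rho (d :: s).
  by have := IHs d 0%N; rewrite addr0 big_ord0 subr0 => ->.
have [dE|xd] := eqVneq d (x + n%:Z + 1); last first.
  rewrite [K d _]K_far ?mul0r ?subr0; last by lia.
  apply: kernel_gap => z; rewrite inE => /orP[/eqP->|zs]; first by lia.
  have /allP/(_ z zs) := order_path_min lt_trans ds; lia.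
have dE' : d = x + n.+1%:Z by lia.
(* Without a gap, the subdiagonal entry -1 adds the induction hypothesis for [n.+1], whose term
   [l = n] cancels the product [K x (x + n) * rho (d :: s)]. *)
rewrite dE K_sub -dE mulN1r opprK dE' IHs -?dE'// itv_seqS cat_rcons.
rewrite big_ord_recr/= subnn /= opprD [X in _ + X]addrA addrC.
rewrite addNKr; congr (_ - _).
apply: eq_bigr => l _; rewrite subSn ?ltn_ord// itv_seqS cat_rcons.
by have -> : x + l.+1%:Z + (n - l.+1)%N%:Z = x + n%:Z by have := ltn_ord l; lia.
Qed.

Lemma det_kernel_tuple n (t : n.-tuple int) : sorted <%R t ->
  \det (\matrix_(i < n, j < n) K (tnth t i) (tnth t j)) = rho t.
Proof.
case: t => s size_s /=; have Dn := eqP size_s; subst n => sorted_s.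
under eq_mx do rewrite !(tnth_nth 0) /=.
case: s size_s sorted_s => [|c s] size_s sorted_s.
  by rewrite det_mx00 rho_nil.
rewrite (_ : matrix_of_fun _ _ = row0_matrix K c (c :: s)).
  by have := @det_row0_rho c 0 s; rewrite addr0 big_ord0 subr0 => ->.
by apply/matrixP => i j; rewrite !mxE; case: i => [[|i] hi].
Qed.

End OneDependentDeterminant.

(** Rows and columns undergo the same permutation, so its sign enters squared. *)
Lemma det_tuple_perm {F : comNzRingType} {T : eqType} (K : T -> T -> F) n
    (s t : n.-tuple T) : perm_eq s t ->
  \det (\matrix_(i < n, j < n) K (tnth s i) (tnth s j)) =
  \det (\matrix_(i < n, j < n) K (tnth t i) (tnth t j)).
Proof.
case/tuple_permP => p sE; set M := (X in _ = \det X).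
have -> : s = [tuple tnth t (p i) | i < n] by apply: val_inj.
rewrite (_ : matrix_of_fun _ _ = row_perm p (col_perm p M)).
  rewrite row_permE col_permE !det_mulmx !det_perm odd_permV.
  by rewrite mulrCA -expr2 sqrr_sign mulr1.
by apply/matrixP => i j; rewrite !mxE !tnth_mktuple.
Qed.

(** * Chain sums and inversion of a unitriangular matrix *)

Section Chains.
Context {F : comNzRingType} (w : nat -> nat -> F).

(** Entry (0, n) of the r-th power of the strictly upper triangular part of [w]. *)
Fixpoint chain_weight (r n : nat) : F :=
  if r is r'.+1 then \sum_(m < n) chain_weight r' m * w m n else (n == 0%N)%:R.

Lemma chain_weight_gt r n : (n < r)%N -> chain_weight r n = 0.
Proof.
elim: r n => [|r IHr] n //= ltnr; rewrite big1// => m _.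
by rewrite IHr ?mul0r// (leq_trans (ltn_ord m)).
Qed.

(* The codomain 'I_N.+1 is kept independent of the endpoint n so that the
   induction on r can remove the last point of a chain. *)
Lemma sum_chain_weight N r (n : 'I_N.+1) :
  \sum_(t : {ffun 'I_r.+1 -> 'I_N.+1} |
      [&& t ord0 == ord0, t ord_max == n &
        [forall i : 'I_r, (t (inord i) < t (inord i.+1))%N]])
    \prod_(i < r) w (t (inord i)) (t (inord i.+1)) = chain_weight r n.
Proof.
elim: r n => [|r IHr] n /=.
  have max0 : ord_max = ord0 :> 'I_1 by apply: val_inj.
  have [->|n0] := eqVneq n ord0; last first.
    rewrite (negPf (n0 : n != 0%N :> nat)) big1// => t /and3P[/eqP t0].
    by rewrite max0 t0 eq_sym (negPf n0).
  rewrite (big_pred1 [ffun=> ord0]) ?big_ord0// => t.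
  rewrite max0 andbA andbb; apply/andP/eqP => [[/eqP t0 _]|->].
    by apply/ffunP => i; rewrite ffunE ord1.
  by split; [rewrite ffunE | apply/forallP => -[]].
(* [ext] appends the fixed endpoint [n] to a chain and [res] forgets the last point. *)
pose ext (u : {ffun 'I_r.+1 -> 'I_N.+1}) : {ffun 'I_r.+2 -> 'I_N.+1} :=
  [ffun i => if unlift ord_max i is Some j then u j else n].
pose res (t : {ffun 'I_r.+2 -> 'I_N.+1}) : {ffun 'I_r.+1 -> 'I_N.+1} :=
  [ffun j => t (lift ord_max j)].
have ext_max u : ext u ord_max = n by rewrite ffunE unlift_none.
have ext_inord u k : (k <= r)%N -> ext u (inord k) = u (inord k).
  move=> ler; rewrite ffunE.
  have -> : inord k = lift ord_max (inord k : 'I_r.+1) :> 'I_r.+2.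
    by apply: val_inj; rewrite /= /bump !inordK//; lia.
  by rewrite liftK.
have ext0 u : ext u ord0 = u ord0.
  by rewrite (_ : ord0 = inord 0) ?ext_inord//; [congr (u _)|];
    apply: val_inj; rewrite /= inordK.
have inord_max k : inord k = ord_max :> 'I_k.+1.
  by apply: val_inj; rewrite /= inordK.
have ext_chain u : [forall i : 'I_r.+1, (ext u (inord i) < ext u (inord i.+1))%N]
    = [forall i : 'I_r, (u (inord i) < u (inord i.+1))%N] && (u ord_max < n)%N.
  apply/forallP/andP => [H|[/forallP H ltn] i].
    split; last by have := H ord_max; rewrite ext_inord// !inord_max ext_max.
    apply/forallP => i; have := H (widen_ord (leqnSn r) i).
    by rewrite !ext_inord//= ltnW.
  have [ltir|leri] := ltnP i r.
    by rewrite !ext_inord ?(ltnW ltir)//; exact: H (Ordinal ltir).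
  have -> : i = r :> nat by apply/eqP; rewrite eqn_leq leri -ltnS ltn_ord.
  by rewrite ext_inord// !inord_max ext_max.
have resK u : res (ext u) = u by apply/ffunP => i; rewrite !ffunE liftK.
rewrite (reindex_onto ext res) => [|t /and3P[_ /eqP tn _]]; last first.
  apply/ffunP => i; rewrite ffunE; case: unliftP => [j ->|->//].
  by rewrite ffunE.
rewrite (big_ord_widen N.+1 (fun m => chain_weight r m * w m n)); last exact/ltnW.
under eq_bigl => u do rewrite ext0 ext_max ext_chain resK !eqxx/= andbT.
under eq_bigr => u _ do rewrite big_ord_recr /= ext_inord// !inord_max ext_max.
under eq_bigr => u _ do under eq_bigr => i _ do
  rewrite !ext_inord ?(ltnW (ltn_ord i))//.
(* Chains are grouped by their penultimate point [m], the summation index of [chain_weight]. *)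
rewrite (partition_big (fun u : {ffun _ -> _} => u ord_max)
  (fun m : 'I_N.+1 => (m < n)%N)) /= => [|u /and3P[]//].
apply: eq_bigr => m ltmn; rewrite -IHr mulr_suml.
apply: eq_big => u; last by case/andP => _ /eqP->.
have [->|] := eqVneq (u ord_max) m; last by rewrite !andbF.
by rewrite ltmn !andbT.
Qed.

(* Up to sign, entry (0, n) of the inverse of the unitriangular matrix w. *)
Definition signed_chains (n : nat) : F :=
  - \sum_(r < n.+1) (-1) ^+ r * chain_weight r n.

Lemma signed_chains0 : signed_chains 0 = -1.
Proof. by rewrite /signed_chains big_ord1 mul1r. Qed.

(** Terms with [r > n] vanish; a bound independent of [n] makes the double sum in [signed_chainsS]
    exchangeable. *)
Lemma signed_chainsE N n : (n <= N)%N ->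
  signed_chains n = - \sum_(r < N.+1) (-1) ^+ r * chain_weight r n.
Proof.
rewrite -ltnS => lenN; congr (- _).
rewrite (big_ord_widen _ (fun r => (-1) ^+ r * chain_weight r n) lenN).
rewrite [RHS](bigID (fun r : 'I_N.+1 => (r < n.+1)%N)) /=.
rewrite [X in _ + X]big1 ?addr0// => r; rewrite -leqNgt => /chain_weight_gt->.
by rewrite mulr0.
Qed.

(** Removing the last link of each chain flips its sign. *)
Lemma signed_chainsS n :
  signed_chains n.+1 = - \sum_(m < n.+1) signed_chains m * w m n.+1.
Proof.
rewrite {1}/signed_chains big_ord_recl /= mulr0 add0r -sumrN -[RHS]sumrN.
under [RHS]eq_bigr => m _.
  rewrite (signed_chainsE n m (leq_ord m)) mulNr opprK mulr_suml; over.
rewrite exchange_big; apply: eq_bigr => r _ /=.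
rewrite exprS mulN1r mulNr opprK mulr_sumr.
by apply: eq_bigr => m _; rewrite mulrA.
Qed.

(** The off-diagonal entry (0, n + 1) of the inverse times [w] is zero; its term [l = 0] has been
    moved to the right. *)
Lemma sum_signed_chains n : w n.+1 n.+1 = 1 ->
  \sum_(l < n.+1) signed_chains l.+1 * w l.+1 n.+1 = w 0%N n.+1.
Proof.
move=> w1; rewrite big_ord_recr /= w1 mulr1 signed_chainsS big_ord_recl /=.
by rewrite signed_chains0 mulN1r opprD opprK addrCA subrr addr0.
Qed.

End Chains.

(** * Correlations and the kernel on lists of integers *)

Section PointProcessCorrelation.
Context {R : realType} {X : set int} (P : probability (configuration X) R).

(* The points of s outside X are ignored, so that the identities between the
   numbers seq_correlation s hold for every list of integers. *)
Definition seq_correlation (s : seq int) : R :=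
  correlation P [set z : X | val z \in s].

Lemma seq_correlation_nil : seq_correlation [::] = 1.
Proof.
rewrite /seq_correlation /correlation (_ : [set S | _] = setT).
  by rewrite probability_setT.
by apply/seteqP; split => // S _ z.
Qed.

Lemma eq_seq_correlation s t : s =i t -> seq_correlation s = seq_correlation t.
Proof.
move=> st; congr (correlation P _).
by apply/seteqP; split => z /=; rewrite st.
Qed.

Definition fset_in (s : seq int) : {fset X} :=
  [fset z in pmap insub s]%fset.

Lemma in_fset_in s (z : X) : (z \in fset_in s) = (val z \in s).
Proof. by rewrite !inE mem_pmap_sub. Qed.

Lemma seq_correlation_cat s t : one_dependent P ->
  (forall x y, x \in s -> y \in t -> x + 2 <= y) ->
  seq_correlation (s ++ t) = seq_correlation s * seq_correlation t.
Proof.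
move=> HP far.
have fsetE u : [set z : X | val z \in u] = [set` fset_in u].
  by apply/seteqP; split => z /=; rewrite in_fset_in.
rewrite /seq_correlation !fsetE -HP => [|x y].
  congr (correlation P _); apply/seteqP; split => z /=.
    by rewrite !in_fset_in mem_cat => /orP.
  by rewrite !in_fset_in mem_cat => ?; apply/orP.
by rewrite !in_fset_in => xs yt; have := far _ _ xs yt; lia.
Qed.

Lemma rho_itvE (x : int) (m n : nat) :
  rho_itv P (x + m%:Z) (x + n%:Z) = seq_correlation (itv_seq (x + m%:Z) (n - m)).
Proof.
congr (correlation P _); apply/seteqP; split => z /=; rewrite mem_itv_seq; lia.
Qed.

Definition int_kernel (x y : int) : R :=
  if 2 <= x - y then 0 else if x - y == 1 then -1 else
  signed_chains (fun m n => rho_itv P (x + m%:Z) (x + n%:Z)) `|y - x|%N.+1.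

Lemma one_dependent_kernelE (x y : X) :
  one_dependent_kernel P x y = (int_kernel (val x) (val y))%:C%C.
Proof.
rewrite /one_dependent_kernel /int_kernel; case: ifP => // _.
case: ifP => _; first by rewrite rmorphN rmorph1.
congr (_%:C)%C; set N := `|_|%N; rewrite big_add1 big_mkord.
(* The term [r = 0] vanishes, since a chain of positive length has a link; the outer minus sign
   turns the exponent [r] into [r - 1]. *)
rewrite /signed_chains [in RHS]big_ord_recl /= mulr0 add0r -sumrN.
apply: eq_bigr => r _; rewrite exprS mulN1r mulNr opprK; congr (_ * _).
rewrite /chain_sum /is_chain.
exact: (@sum_chain_weight R
  (fun m n => rho_itv P (val x + m%:Z) (val x + n%:Z)) N.+1 r.+1 ord_max).
Qed.

Lemma seq_correlation_itv_seq (x : int) (n : nat) :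
  seq_correlation (itv_seq x n.+1) = \sum_(l < n.+1)
    int_kernel x (x + l%:Z) * seq_correlation (itv_seq (x + l.+1%:Z) (n - l)).
Proof.
pose w m n := rho_itv P (x + m%:Z) (x + n%:Z).
have := @sum_signed_chains R w n.
(* The diagonal weight is the correlation of an empty interval, hence 1. *)
rewrite /w !rho_itvE subnn seq_correlation_nil => /(_ erefl).
rewrite addr0 subn0 => <-; apply: eq_bigr => l _.
rewrite rho_itvE subSS; congr (_ * _); rewrite /int_kernel !ifF; [|lia|lia].
by congr (signed_chains _ _.+1); lia.
Qed.

Lemma int_kernel_correlation (HP : one_dependent P) n (t : n.-tuple int) :
  uniq t ->
  \det (\matrix_(i < n, j < n) int_kernel (tnth t i) (tnth t j)) =
  seq_correlation t.
Proof.
(* Sorting changes neither the determinant nor the correlation, and yields the increasing list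
   required by [det_kernel_tuple]. *)
move=> uniq_t; pose s := [tuple of sort <=%R t].
have st : perm_eq s t by rewrite perm_sort.
rewrite -(det_tuple_perm int_kernel _ _ _ st).
rewrite (@det_kernel_tuple _ seq_correlation) //.
- exact/eq_seq_correlation/perm_mem.
- exact: seq_correlation_nil.
- by move=> u v; exact: seq_correlation_cat.
- by move=> x y ?; rewrite /int_kernel ifT//; lia.
- by move=> y; rewrite /int_kernel ifF ?ifT//; lia.
- exact: seq_correlation_itv_seq.
- by rewrite lt_sorted_uniq_le sort_uniq uniq_t sort_le_sorted.
Qed.

End PointProcessCorrelation.

Theorem theorem7p1 (R : realType) (X : set int) (HX : is_interval X)
    (P : probability (configuration X) R) (HP : one_dependent P) :
  determinantal P /\ is_correlation_kernel P (one_dependent_kernel P).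
Proof.
suff H : is_correlation_kernel P (one_dependent_kernel P).
  by split=> //; exists (one_dependent_kernel P).
move=> A; pose f (i : 'I_#|{: A}|) : int := val (val (enum_val i)).
pose t : #|{: A}|.-tuple int := [tuple f i | i < #|{: A}|].
have uniq_t : uniq t.
  rewrite map_inj_uniq ?enum_uniq// => i j /val_inj/val_inj.
  exact: enum_val_inj.
(* The complex matrix is the image of a real one, so the determinant is computed over [R]. *)
rewrite (_ : kernel_matrix _ _ = map_mx (real_complex R)
    (\matrix_(i, j) int_kernel P (tnth t i) (tnth t j))); last first.
  by apply/matrixP => i j; rewrite !mxE !tnth_mktuple one_dependent_kernelE.
rewrite det_map_mx int_kernel_correlation//; congr (_%:C)%C.
congr (correlation P _); apply/seteqP; split => z /=.
  move=> zA; apply/mapP; exists (enum_rank [` zA]%fset).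
    by rewrite mem_enum.
  by rewrite /f enum_rankK.
by case/mapP => i _ /val_inj->; exact: fsvalP.
Qed.
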